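(* Let $X$ be a finite dimensional Banach space such that the dual $X^*$ is polyhedral. Then $X$ has property (co2) (and hence property (co)).
   Context: Banach spaces are over the scalar field $\mathbb K$, where $\mathbb K=\mathbb R$ or $\mathbb K=\mathbb C$. $B_X$ denotes the closed unit ball of $X$, $\operatorname{ext}B_X$ its set of extreme points, $\mathbb T=\{\alpha\in\mathbb K:|\alpha|=1\}$, and $B(x,\delta)=\{y\in X:\|y-x\|<\delta\}$. A finite dimensional real Banach space $X$ is called polyhedral if $\operatorname{ext}B_X$ is a finite set. A finite dimensional complex Banach space $X$ is called polyhedral if there exists a finite set $A\subset\operatorname{ext}B_X$ such that $\operatorname{ext}B_X=\mathbb T\cdot A$. For $n\in\mathbb N$, $n\ge2$, a point $x\in B_X$ satisfies condition (co$n$) if: whenever $x_1,\dots,x_n\in B_X$ and $\lambda_1,\dots,\lambda_n>0$, $\sum_{j=1}^n\lambda_j=1$, are such that $x=\sum_{j=1}^n\lambda_jx_j$, and $\varepsilon>0$, there is a $\delta>0$ such that, setting $B:=B(x,\delta)\cap B_X$, there are (norm-)continuous functions $\widehat v_j:B\to B_X$, $j\in\{1,\dots,n\}$, such that for every $u\in B$ one has $u=\sum_{j=1}^n\lambda_j\widehat v_j(u)$ and $\|\widehat v_j(u)-x_j\|<\varepsilon$ for every $j\in\{1,\dots,n\}$. A point $x\in B_X$ has property (co) if it satisfies (co$n$) for every $n\ge2$, and property (co2) if it satisfies (co$n$) for $n=2$. The space $X$ has property (co) (respectively (co2)) if every point of $B_X$ has it. *)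

(* Defs.v *)
From HB Require Import structures.
From mathcomp Require Import all_boot all_order all_algebra.
From mathcomp Require Import all_classical all_reals all_analysis.
From mathcomp Require Import complex.

Set Implicit Arguments.
Unset Strict Implicit.
Unset Printing Implicit Defensive.

Import Order.TTheory GRing.Theory Num.Theory.
Import numFieldNormedType.Exports.

Local Open Scope classical_set_scope.
Local Open Scope ring_scope.

Variant scalar_kind := RealScalars | ComplexScalars.

Definition scalars (R : realType) (k : scalar_kind) : numFieldType :=
  match k with RealScalars => R | ComplexScalars => R[i] end.

(* In both cases the order is the one of [numFieldType]: in R[i], [x <= y]
   means that [y - x] is a nonnegative real number, and norms take their values
   in the field of scalars.  Bounded sets of nonnegative scalars have a least
   upper bound, which is what the dual norm needs. *)
Lemma scalars_supremum (R : realType) (k : scalar_kind) (A : set (scalars R k)) :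
    A !=set0 -> (forall a, A a -> 0 <= a) -> ubound A !=set0 ->
  supremums A !=set0.
Proof.
case: k A => A [a Aa] A_ge0 [M MA]; rewrite /scalars in A a Aa A_ge0 M MA *.
  have supA : has_sup A by split; [exists a | exists M].
  by exists (sup A); split=> [x Ax|x ubx]; [apply: ub_le_sup => //; exact: supA.2
    | apply: ge_sup => //; exact: supA.1].
pose B : set R := [set x | A x%:C%C].
have realA x : A x -> x = (complex.Re x)%:C%C.
  by move=> /A_ge0; case: x => x y; rewrite lecE/= => /andP[/eqP -> _].
have reM x : A x -> complex.Re x <= complex.Re M.
  by move=> /MA; case: x M {MA} => x y [u v]; rewrite lecE/= => /andP[].
have supB : has_sup B.
  split; first by exists (complex.Re a); rewrite /B/= -realA.
  by exists (complex.Re M) => x /reM.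
exists (sup B)%:C%C; split=> [x Ax|x ubx].
  rewrite (realA x Ax) lecR; apply: ub_le_sup; first exact: supB.2.
  by rewrite /B/= -realA.
have := le_trans (A_ge0 _ Aa) (ubx _ Aa).
case: x ubx => x y ubx; rewrite !lecE/= => /andP[/eqP -> _]; rewrite eqxx/=.
apply: ge_sup; first exact: supB.1.
by move=> z /ubx; rewrite lecE/= => /andP[].
Qed.

Definition unit_ball (K : numFieldType) (X : normedModType K) : set X :=
  [set x | `|x| <= 1].
Arguments unit_ball {K} X.

(* An inequality [0 < t < 1] in R[i] forces [t] to be real. *)
Definition extreme_points (K : numFieldType) (X : lmodType K) (C : set X) :
    set X :=
  [set x | C x /\ forall (y z : X) (t : K), C y -> C z -> 0 < t < 1 ->
             x = t *: y + (1 - t) *: z -> y = x /\ z = x].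

Definition finite_dimensional (K : numFieldType) (X : lmodType K) : Prop :=
  exists (n : nat), exists2 v2r : X -> 'rV[K]_n, linear v2r & bijective v2r.

Definition polyhedral (R : realType) (k : scalar_kind)
    (X : normedModType (scalars R k)) : Prop :=
  let ext := extreme_points (unit_ball X) in
  match k with
  | RealScalars => finite_set ext
  | ComplexScalars => exists A : set X,
      [/\ finite_set A, A `<=` ext &
          ext = [set p.1 *: p.2 | p in [set a : scalars R k | `|a| = 1] `*` A]]
  end.

Section Dual.
Variables (R : realType) (k : scalar_kind).
Let K : numFieldType := scalars R k.
Variable X : normedModType K.

Definition functional : {pred X -> K} :=
  [pred f : X -> K | `[< linear f /\ continuous f >]].

Record dual := Dual { dual_fun :> X -> K; dual_funP : dual_fun \in functional }.

HB.instance Definition _ := [isSub for dual_fun].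
HB.instance Definition _ := [Choice of dual by <:].

Lemma functional_submod_closed : submod_closed functional.
Proof.
split.
  apply/asboolP; split; first by move=> a x y; rewrite /= scaler0 addr0.
  by move=> x; exact: cvg_cst.
move=> a f g /asboolP[lf cf] /asboolP[lg cg]; apply/asboolP; split.
  move=> b x y.
  rewrite /= !fctE lf lg !scalerDr !scalerA [a * b]mulrC -!addrA; congr (_ + _).
  by rewrite addrCA.
by move=> x; apply: cvgD; [apply: cvgZl_tmp; exact: cf | exact: cg].
Qed.

HB.instance Definition _ :=
  GRing.isSubmodClosed.Build K (X -> K) functional functional_submod_closed.
HB.instance Definition _ := [SubChoice_isSubLmodule of dual by <:].

Lemma dual_linear (f : dual) : linear f.
Proof. by have /asboolP[] := dual_funP f. Qed.

HB.instance Definition _ (f : dual) :=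
  GRing.isLinear.Build K X K *:%R (dual_fun f) (dual_linear f).

Lemma dual_continuous (f : dual) : continuous f.
Proof. by have /asboolP[] := dual_funP f. Qed.

Definition dual_norm (f : dual) : K :=
  supremum 0 [set `|f x| | x in unit_ball X].

Lemma dual_normP (f : dual) :
  supremums [set `|f x| | x in unit_ball X] (dual_norm f).
Proof.
have A0 : [set `|f x| | x in unit_ball X] !=set0.
  by exists `|f 0|, 0; rewrite // /unit_ball/= normr0.
rewrite /dual_norm /supremum ifF; last exact/negbTE/set0P.
suff: supremums [set `|f x| | x in unit_ball X] !=set0.
  by case=> s; exact: xgetI.
apply: scalars_supremum => //; first by move=> _ [x _ <-].
have /linear_bounded_continuous/bounded_funP/(_ 1)[M fM] := @dual_continuous f.
by exists M => _ [x x1 <-]; exact: fM.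
Qed.

Lemma dual_norm_ge (f : dual) (x : X) : `|x| <= 1 -> `|f x| <= dual_norm f.
Proof. by move=> x1; apply: (dual_normP f).1; exists x. Qed.

Lemma dual_norm_le (f : dual) (M : K) :
  (forall x, `|x| <= 1 -> `|f x| <= M) -> dual_norm f <= M.
Proof. by move=> fM; apply: (dual_normP f).2 => _ [x x1 <-]; exact: fM. Qed.

Lemma dual_normD (f g : dual) : dual_norm (f + g) <= dual_norm f + dual_norm g.
Proof.
apply: dual_norm_le => x x1.
by rewrite (le_trans (ler_normD _ _))// lerD// dual_norm_ge.
Qed.

Lemma dual_normZ (a : K) (f : dual) : dual_norm (a *: f) = `|a| * dual_norm f.
Proof.
have le b g : dual_norm (b *: g) <= `|b| * dual_norm g.
  by apply: dual_norm_le => x x1; rewrite [`|_|]normrM ler_wpM2l// dual_norm_ge.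
apply/eqP; rewrite eq_le le/=; have [->|a0] := eqVneq a 0.
  by rewrite normr0 mul0r (le_trans _ (dual_norm_ge _ (x := 0) _)) ?normr0.
rewrite mulrC -ler_pdivlMr ?normr_gt0// mulrC -normfV.
by rewrite -[leLHS]/(dual_norm f) -{1}[f](scalerK a0) le.
Qed.

Lemma dual_norm0_eq0 (f : dual) : dual_norm f = 0 -> f = 0.
Proof.
move=> f0; apply/val_inj/funext => x; rewrite /=.
have [->|x0] := eqVneq x 0; first exact: (linear0 f).
have : `|f (`|x|^-1 *: x)| <= 0.
  by rewrite -f0 dual_norm_ge// normrZ normfV normr_id mulVf// normr_eq0.
rewrite normr_le0 linearZ/= scaler_eq0 invr_eq0 normr_eq0 (negbTE x0)/=.
by move/eqP.
Qed.

HB.instance Definition _ :=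
  Lmodule_isNormed.Build K dual dual_normD dual_normZ dual_norm0_eq0.

End Dual.

Section ConditionCo.
Variables (K : numFieldType) (X : normedModType K).

(* The functions take values in [X] and are only constrained on
   [ball x delta `&` unit_ball X]. *)
Definition co_cond (n : nat) (x : X) : Prop :=
  forall (y : 'I_n -> X) (lambda : 'I_n -> K),
    (forall j, unit_ball X (y j)) -> (forall j, 0 < lambda j) ->
    \sum_(j < n) lambda j = 1 -> x = \sum_(j < n) lambda j *: y j ->
  forall eps : K, 0 < eps ->
  exists2 delta : K, 0 < delta &
  let B := ball x delta `&` unit_ball X in
  exists v : 'I_n -> X -> X,
    [/\ forall j, {within B, continuous (v j)},
        forall j u, B u -> unit_ball X (v j u),
        forall u, B u -> u = \sum_(j < n) lambda j *: v j u &
        forall j u, B u -> `|v j u - y j| < eps].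

Definition property_co2 : Prop := forall x, unit_ball X x -> co_cond 2 x.

Definition property_co : Prop :=
  forall x, unit_ball X x -> forall n, (2 <= n)%N -> co_cond n x.

End ConditionCo.
Arguments property_co2 {K} X.
Arguments property_co {K} X.

(* Main.v *)
Require Import Defs.
From HB Require Import structures.
From mathcomp Require Import all_boot all_order all_algebra.
From mathcomp Require Import all_classical all_reals all_analysis.
From mathcomp Require Import complex.
From mathcomp Require Import ring lra.

(** The unit ball of [X] is cut out by finitely many functionals, and this alone
    makes the vectors of a convex combination follow its sum by translation.

    The extreme points of the dual ball norm [X] (Hahn-Banach and Krein-Milman:
    [extreme_norming_functional]), and polyhedrality says that up to unimodular
    factors, which [|f x|] ignores, there are finitely many of them.  So there
    is a finite set [A] of functionals such that [|x| <= 1] if and only if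
    [|f x| <= 1] for all [f] in [A] ([polyhedral_finite_norming]).

    Let [x = \sum_j l_j y_j] be a convex combination in the ball.  For [f] in
    [A] with [|f x| = 1], strict convexity of the disc of scalars gives
    [f y_j = f x] for all [j] ([disc_strictly_convex]).  Move every [y_j]
    slightly towards [x], to [z_j = (1 - t) y_j + t x]; then [|f z_j| < 1] for
    the other [f] in [A], with a gap because [A] is finite.  The maps
    [v_j u = z_j + (u - x)] satisfy [\sum_j l_j v_j u = u], and for [u] in the
    ball near [x] they stay in the ball: if [|f x| = 1] then [f (v_j u) = f u],
    and otherwise the gap absorbs [u - x].

    The norming extreme points are obtained without compactness.  Given a
    sublinear [p] and a vector [e], the linear functionals below [p] that take
    the value [p e] at [e] are those below another sublinear functional
    [q <= p], and they form a face of the functionals below [p]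
    ([sublinear_supporting_face]).  Repeating this with [e] running through a
    finite spanning family ends with a sublinear functional that is linear, and
    it is an extreme point of the set of linear functionals below [p].  With
    [p] the norm and [x] as the first vector [e], it takes the value [|x|] at
    [x].  All this concerns real-linear functionals; a scalar-linear functional
    is determined by its real part, which can be any real-linear functional. *)

Set Implicit Arguments.
Unset Strict Implicit.
Unset Printing Implicit Defensive.

Import Order.TTheory GRing.Theory Num.Theory.
Import numFieldNormedType.Exports.
Local Open Scope classical_set_scope.
Local Open Scope ring_scope.

(** * Sublinear functionals and their extreme linear minorants *)

Section Sublinear.
Variables (R : realType) (K : nzRingType) (iota : {rmorphism R -> K}).
Variable X : lmodType K.
Implicit Types (p q g : X -> R) (x y e v : X).

Definition sublinear p :=
  (forall x y, p (x + y) <= p x + p y) /\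
  (forall r x, 0 <= r -> p (iota r *: x) = r * p x).

Definition real_linear g :=
  (forall x y, g (x + y) = g x + g y) /\
  (forall r x, g (iota r *: x) = r * g x).

(** The real subspace spanned by [s], given by its induction principle: that is
    the way in which it is used. *)
Definition real_span (s : seq X) : set X :=
  [set x | forall P : set X, P 0 -> (forall y z, P y -> P z -> P (y + z)) ->
     (forall r y, P y -> P (iota r *: y)) -> (forall e, e \in s -> P e) -> P x].

Lemma real_linear0 g : real_linear g -> g 0 = 0.
Proof. by case=> _ /(_ 0 0); rewrite scaler0 mul0r. Qed.

Lemma real_linearN g v : real_linear g -> g (- v) = - g v.
Proof.
move=> lg; have := lg.1 v (- v); rewrite subrr (real_linear0 lg); lra.
Qed.

Lemma real_linear_le_eq g h :
  real_linear g -> real_linear h -> (forall v, g v <= h v) -> g = h.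
Proof.
move=> lg lh gh; apply/funext => v; have := gh v; have := gh (- v).
by rewrite !real_linearN//; lra.
Qed.

Lemma sublinear0 p : sublinear p -> p 0 = 0.
Proof. by case=> _ /(_ 0 0 (lexx _)); rewrite scaler0 mul0r. Qed.

Lemma sublinearN_ge0 p v : sublinear p -> 0 <= p v + p (- v).
Proof. by move=> sp; rewrite -(sublinear0 sp) -(subrr v); exact: sp.1. Qed.

(** The functional is [q v = inf_(t >= 0) (p (v + t e) - t p e)].  If [g] is
    linear, [g <= p] and [g e = p e], then [g v = g (v + t e) - t g e] is at
    most each of these terms. *)
Lemma sublinear_directional_inf p e : sublinear p ->
  exists q, [/\ sublinear q, forall v, q v <= p v, q (- e) <= - p e &
    forall g, real_linear g -> (forall v, g v <= p v) -> p e <= g e ->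
    forall v, g v <= q v].
Proof.
move=> sp; have [pD pZ] := sp.
pose S v := [set p (v + iota t *: e) - t * p e | t in [set t : R | 0 <= t]].
(* From [p (t e) <= p (v + t e) + p (- v)]. *)
have lbS v r : S v r -> - p (- v) <= r.
  move=> [t t0 <-]; have := pD (v + iota t *: e) (- v).
  by rewrite addrC addKr pZ//; lra.
have infS v : has_inf (S v).
  split; last by exists (- p (- v)) => r /lbS.
  by exists (p (v + iota 0 *: e) - 0 * p e), 0 => /=.
have Sle v t : 0 <= t -> inf (S v) <= p (v + iota t *: e) - t * p e.
  by move=> t0; apply: ge_inf; [exact: (infS v).2 | exists t].
have Sge v b : (forall t, 0 <= t -> b <= p (v + iota t *: e) - t * p e) ->
    b <= inf (S v).
  by move=> h; apply: lb_le_inf; [exact: (infS v).1 | move=> _ [t t0 <-]; exact: h].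
exists (fun v => inf (S v)); split.
- split=> [x y|r x].
    rewrite -lerBlDr; apply: (Sge) => t t0; rewrite lerBlDl -lerBlDr.
    apply: (Sge) => u u0; rewrite lerBlDr.
    apply: le_trans (Sle _ _ (addr_ge0 u0 t0)) _.
    have := pD (y + iota u *: e) (x + iota t *: e).
    by rewrite addrACA -scalerDl -rmorphD/= [y + x]addrC; lra.
  rewrite le_eqVlt => /predU1P[<-|r0].
    rewrite rmorph0 scale0r mul0r; apply/eqP; rewrite eq_le; apply/andP; split.
      by have := Sle 0 0 (lexx _); rewrite rmorph0 scale0r addr0 mul0r subr0 sublinear0.
    by apply: (Sge) => t t0; rewrite add0r pZ// subrr.
  (* Scaling [v] by [s] amounts to replacing [t] by [s t]. *)
  have key s y t : 0 < s ->
    p (iota s *: y + iota (s * t) *: e) - s * t * p e =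
    s * (p (y + iota t *: e) - t * p e).
    by move=> s0; rewrite rmorphM -scalerA -scalerDr pZ ?ltW//; ring.
  apply/eqP; rewrite eq_le; apply/andP; split.
    rewrite -ler_pdivrMl//; apply: (Sge) => t t0; rewrite ler_pdivrMl// -key//.
    by apply: (Sle); rewrite mulr_ge0// ltW.
  apply: (Sge) => t t0; have {1 2}-> : t = r * (r^-1 * t) by rewrite mulVKf// gt_eqF.
  by rewrite key// ler_pM2l//; apply: (Sle); rewrite mulr_ge0// invr_ge0 ltW.
- by move=> v; have := Sle v 0 (lexx _); rewrite rmorph0 scale0r addr0 mul0r subr0.
- have := Sle (- e) 1 ler01.
  by rewrite rmorph1 scale1r addNr mul1r sublinear0// sub0r.
- move=> g [gD gZ] gp ge v; apply: (Sge) => t t0.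
  have := gp (v + iota t *: e); rewrite gD gZ.
  by have := ler_wpM2l t0 ge; lra.
Qed.

(** The linear functionals below [q] form a face of those below [p].  Only [g]
    is mentioned in the conclusion, since [t] and [1 - t] can be exchanged. *)
Definition lower_face p q := forall g h t, real_linear g -> real_linear h ->
  (forall v, g v <= p v) -> (forall v, h v <= p v) -> 0 < t < 1 ->
  (forall v, t * g v + (1 - t) * h v <= q v) -> forall v, g v <= q v.

Lemma lower_face_refl p : lower_face p p. Proof. by []. Qed.

Lemma lower_face_trans p q r :
  (forall v, r v <= q v) -> lower_face p q -> lower_face q r -> lower_face p r.
Proof.
move=> rq pq qr g h t lg lh gp hp t01 ghr.
have ghq v : t * g v + (1 - t) * h v <= q v by exact: le_trans (ghr v) (rq v).
apply: (qr g h t) => //; first exact: (pq g h t).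
apply: (pq h g (1 - t)) => // [|v]; first by move: t01; lra.
by rewrite subKr addrC.
Qed.

(** From [t g + (1 - t) h <= q] and [q (- e) <= - p e] one gets
    [t g e + (1 - t) h e >= p e], and as [g e] and [h e] are at most [p e], both
    are equal to it. *)
Lemma sublinear_supporting_face p e : sublinear p ->
  exists q, [/\ sublinear q, forall v, q v <= p v, q (- e) <= - p e &
    lower_face p q].
Proof.
move=> sp; have [q [sq qp qe qmax]] := sublinear_directional_inf e sp.
exists q; split=> // g h t lg lh gp hp t01 ghq; apply: qmax => //.
have := le_trans (ghq (- e)) qe; rewrite !real_linearN//.
by have := hp e; move: t01 => /andP[t0 t1]; nra.
Qed.

(** Additivity is [q x = q (x + y - y) <= q (x + y) - q y]. *)
Lemma linear_of_symmetric q : sublinear q ->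
  (forall v, q v + q (- v) <= 0) -> real_linear q.
Proof.
move=> [qD qZ] qN.
have qopp v : q (- v) = - q v.
  by have := qN v; have := sublinearN_ge0 v (conj qD qZ); lra.
split=> [x y|r x].
  apply/eqP; rewrite eq_le qD/=; have := qD (x + y) (- y).
  by rewrite addrK qopp; lra.
have [r0|/ltW r0] := leP 0 r; first exact: (qZ).
by rewrite -[r in iota r]opprK rmorphN scaleNr qopp qZ ?oppr_ge0//; ring.
Qed.

(** A supporting face at [e] forces [q (- e) = - q e], a relation which remains
    true for every smaller sublinear functional.  Once it holds on a spanning
    family it holds everywhere, so the last [q] is linear; then the only linear
    functional below [q] is [q], and [lower_face p q] says that [q] is an extreme
    point. *)
Lemma sublinear_extreme_below p s : sublinear p -> real_span s = setT ->
  exists q, [/\ real_linear q, forall v, q v <= p v & lower_face p q].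
Proof.
move=> sp spans.
have [q [sq qp qs pq]] : exists q, [/\ sublinear q, forall v, q v <= p v,
    forall e, e \in s -> q e + q (- e) <= 0 & lower_face p q].
  elim: s {spans} => [|e s [q [sq qp qs pq]]].
    by exists p; split=> //; exact: lower_face_refl.
  have [r [sr rq re qr]] := sublinear_supporting_face e sq.
  exists r; split=> //; last exact: lower_face_trans pq qr.
  - by move=> v; exact: le_trans (rq v) (qp v).
  - move=> v; rewrite inE => /predU1P[->|/qs].
      by have := rq e; move: re; lra.
    by have := rq v; have := rq (- v); lra.
exists q; split=> //; apply: linear_of_symmetric => // v.
have spanv : real_span s v by rewrite spans.
apply: (spanv (fun v => q v + q (- v) <= 0)) => // [|y z yN zN|r y yN].
- by rewrite oppr0 sublinear0// addr0.
- by have := sq.1 y z; have := sq.1 (- y) (- z); rewrite -opprD; lra.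
- have [r0|/ltW r0] := leP 0 r.
    by rewrite -scalerN !sq.2// -mulrDr mulr_ge0_le0.
  rewrite -[r]opprK rmorphN scaleNr opprK -scalerN !sq.2 ?oppr_ge0//.
  by rewrite -mulrDr mulr_ge0_le0 ?oppr_ge0// addrC.
Qed.

(** Hahn-Banach together with Krein-Milman for the functionals below [p]. *)
Lemma extreme_supporting_functional p s e : sublinear p -> real_span s = setT ->
  exists g, [/\ real_linear g, forall v, g v <= p v, g e = p e & lower_face p g].
Proof.
move=> sp spans; have [q [sq qp qe pq]] := sublinear_supporting_face e sp.
have [g [lg gq qg]] := sublinear_extreme_below sq spans.
exists g; split=> //; last exact: lower_face_trans pq qg.
- by move=> v; exact: le_trans (gq v) (qp v).
- have := le_trans (gq (- e)) qe; have := le_trans (gq e) (qp e).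
  by rewrite real_linearN//; lra.
Qed.

End Sublinear.

(** * Real and complex scalars *)

Section Scalars.
Variables (R : realType) (k : scalar_kind).
Local Notation K := (scalars R k).

Definition real_scalar : R -> K :=
  match k return R -> scalars R k with
  | RealScalars => idfun
  | ComplexScalars => real_complex R
  end.

Definition real_part : K -> R :=
  match k return scalars R k -> R with
  | RealScalars => idfun
  | ComplexScalars => @complex.Re R
  end.

Fact real_scalar_zmod_morphism : zmod_morphism real_scalar.
Proof. by rewrite /real_scalar; case: k => //= x y; rewrite rmorphB. Qed.

Fact real_scalar_monoid_morphism : monoid_morphism real_scalar.
Proof. by rewrite /real_scalar; case: k; split=> //= x y; rewrite rmorphM. Qed.

HB.instance Definition _ := GRing.isZmodMorphism.Build R K real_scalar
  real_scalar_zmod_morphism.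
HB.instance Definition _ := GRing.isMonoidMorphism.Build R K real_scalar
  real_scalar_monoid_morphism.

Lemma real_partD a b : real_part (a + b) = real_part a + real_part b.
Proof. by move: a b; rewrite /real_part; case: k => //= -[? ?] [? ?]. Qed.

Lemma real_partZ r a : real_part (real_scalar r * a) = r * real_part a.
Proof.
move: a; rewrite /real_part /real_scalar; case: k => //= -[x y] /=.
by rewrite mul0r subr0.
Qed.

Lemma real_scalarK : cancel real_scalar real_part.
Proof. by rewrite /real_part /real_scalar; case: k. Qed.

Lemma ge0_real_scalar (a : K) : 0 <= a -> a = real_scalar (real_part a).
Proof.
move: a; rewrite /real_part /real_scalar; case: k => //= -[x y].
by rewrite lecE/= => /andP[/eqP yE _]; rewrite (yE : y = 0).
Qed.

Lemma ler_real_scalar r s : (real_scalar r <= real_scalar s) = (r <= s).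
Proof. by rewrite /real_scalar; case: k => //=; rewrite lecR. Qed.

Lemma ltr_real_scalar r s : (real_scalar r < real_scalar s) = (r < s).
Proof. by rewrite /real_scalar; case: k => //=; rewrite ltcR. Qed.

Lemma real_part_le_norm (a : K) : real_part a <= real_part `|a|.
Proof.
move: a; rewrite /real_part; case: k => [a|[x y]] /=; first exact: ler_norm.
rewrite (le_trans (ler_norm _))// -sqrtr_sqr ler_wsqrtr//.
by rewrite lerDl sqr_ge0.
Qed.

Lemma ler_real_part (a b : K) : 0 <= a -> 0 <= b ->
  (real_part a <= real_part b) = (a <= b).
Proof.
by move=> /ge0_real_scalar-> /ge0_real_scalar->; rewrite !real_scalarK ler_real_scalar.
Qed.

Lemma real_part_eq1 (a : K) : `|a| <= 1 -> real_part a = 1 -> a = 1.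
Proof.
move: a; rewrite /real_part; case: k => [a|[x y]] //= + xE.
rewrite xE normc_def/= (_ : 1 = 1%:C%C)// lecR -[leRHS]sqrtr1 ler_sqrt ?ltr01//.
rewrite expr1n gerDl => y2; suff -> : y = 0 by [].
by apply/eqP; rewrite -sqrf_eq0 eq_le y2 sqr_ge0.
Qed.

Lemma norm_rotation (a : K) : exists2 u : K, `|u| = 1 & u * a = `|a|.
Proof.
have [->|a0] := eqVneq a 0; first by exists 1; rewrite ?normr1 ?mulr0 ?normr0.
exists (`|a| / a); last by rewrite divfK.
by rewrite normrM normr_id normfV divff// normr_eq0.
Qed.

(** Divide by the sum [w]: the real parts of the [w^-1 z_j] are at most [1] and
    average to [1], so all are equal to [1], and in the disc this forces
    [w^-1 z_j = 1]. *)
Lemma disc_strictly_convex n (l z : 'I_n -> K) :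
  (forall j, 0 < l j) -> \sum_j l j = 1 -> (forall j, `|z j| <= 1) ->
  `|\sum_j l j * z j| = 1 -> forall i, z i = \sum_j l j * z j.
Proof.
move=> l0 l1 z1; set w := \sum_j _ => w1 i.
have w0 : w != 0 by rewrite -normr_eq0 w1 oner_eq0.
pose y j := w^-1 * z j.
have y1 j : `|y j| <= 1 by rewrite normrM normfV w1 invr1 mul1r.
have rey j : real_part (y j) <= 1.
  apply: le_trans (real_part_le_norm _) _.
  by rewrite -(real_scalarK 1) rmorph1 ler_real_part.
have sum1 : \sum_j l j * y j = 1.
  by rewrite -(mulVf w0) /w mulr_sumr; apply: eq_bigr => j _; rewrite mulrCA.
pose m j := real_part (l j).
have lE j : l j = real_scalar (m j) by rewrite -ge0_real_scalar// ltW.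
have real_part_sum (F : 'I_n -> K) :
    real_part (\sum_j F j) = \sum_j real_part (F j).
  elim/big_rec2 : _ => [|j a b _ <-]; last exact: real_partD.
  by rewrite -(real_scalarK 0) rmorph0.
have sum0 : \sum_j m j * (1 - real_part (y j)) = 0.
  under eq_bigr do rewrite mulrBr mulr1 -real_partZ -lE.
  by rewrite sumrB -!real_part_sum l1 sum1 subrr.
have m0 j : 0 < m j by rewrite -ltr_real_scalar rmorph0 -lE.
have /eqP := sum0; rewrite psumr_eq0 => [/allP/(_ i)|j _]; last first.
  by rewrite mulr_ge0 ?subr_ge0// ltW.
rewrite mem_index_enum => /(_ isT); rewrite mulf_eq0 gt_eqF//= subr_eq0 eq_sym.
move=> /eqP/(real_part_eq1 (y1 i)) yi.
by rewrite -[LHS](mulVKf w0) -/(y i) yi mulr1.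
Qed.

End Scalars.
Arguments real_scalar {R k}.
Arguments real_part {R k}.

Section Functionals.
Variables (R : realType) (k : scalar_kind).
Local Notation K := (scalars R k).

(** Over the complex numbers, [f x = g x - i g (i x)]. *)
Lemma functional_of_real_part (X : lmodType K) (g : X -> R) :
  real_linear (@real_scalar R k) g ->
  exists f : X -> K, linear f /\ forall x, real_part (f x) = g x.
Proof.
rewrite /real_scalar/real_part; case: k X g => /= X g [gD gZ].
  by exists g; split=> // a x y; rewrite gD gZ.
exists (fun x => (g x +i* - g ('i%C *: x))%C); split=> // a x y.
have gZc (b : R[i]) v :
    g (b *: v) = complex.Re b * g v + complex.Im b * g ('i%C *: v).
  by rewrite {1}[b]complexE [('i * _)%C]mulrC scalerDl -scalerA gD !gZ.
rewrite !scalerDr !gD scalerA gZc (gZc ('i%C * a)); case: a => u v /=.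
by simpc; congr (_ +i* _)%C; ring.
Qed.

(** If [f x] and [h x] differ, rotate [x] so that the difference becomes a
    positive real. *)
Lemma linear_eq_real_part (X : lmodType K) (f h : X -> K) : linear f -> linear h ->
  (forall x, real_part (f x) = real_part (h x)) -> f = h.
Proof.
move=> lf lh fh; apply/funext => x; apply/eqP; rewrite -subr_eq0 -normr_eq0.
have scale (m : X -> K) : linear m -> forall a y, m (a *: y) = a * m y.
  move=> lm a y; pose M : {linear X -> K} :=
    HB.pack m (GRing.isLinear.Build K X K *%R m lm).
  by rewrite -[LHS]/(M (a *: y)) linearZ.
have [u _ uE] := norm_rotation (f x - h x).
rewrite (ge0_real_scalar (normr_ge0 (_ - _))) -uE mulrBr -!scale//.
have := real_partD (f (u *: x) - h (u *: x)) (h (u *: x)); rewrite subrK fh.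
by move/eqP; rewrite -subr_eq subrr => /eqP <-; rewrite rmorph0.
Qed.

Lemma finite_dimensional_real_span (X : lmodType K) :
  finite_dimensional X -> exists s, real_span (@real_scalar R k) s = [set: X].
Proof.
move=> [n [v2r v2r_lin [r2v v2rK r2vK]]].
have [us usP] : exists us : seq K, forall a : K, exists c : K -> R,
    a = \sum_(u <- us) real_scalar (c u) * u.
  (* [us] spans the field of scalars over the reals: [1], or [1] and [i]. *)
  rewrite /real_scalar; case: k => /=.
    by exists [:: 1] => a; exists (fun=> a); rewrite big_seq1 mulr1.
  exists [:: 1; 'i%C] => a.
  exists (fun u => if u == 1 then complex.Re a else complex.Im a).
  rewrite big_cons big_seq1 eqxx ifF; last by rewrite eq_complex/= eq_sym oner_eq0.
  by rewrite mulr1 {1}[a]complexE mulrC.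
exists [seq u *: r2v (delta_mx 0 i) | u <- us, i <- enum 'I_n].
apply/seteqP; split=> // x _ P P0 PD PZ Ps.
have PS (I : eqType) (r : seq I) F :
    (forall i, i \in r -> P (F i)) -> P (\sum_(i <- r) F i).
  move=> PF; rewrite big_seq; elim/big_rec: _ => // i y ir Py.
  by apply: (PD) => //; exact: PF.
pose L : {linear X -> 'rV[K]_n} :=
  HB.pack v2r (GRing.isLinear.Build K X 'rV[K]_n *:%R v2r v2r_lin).
have -> : x = \sum_(i <- enum 'I_n) v2r x 0 i *: r2v (delta_mx 0 i).
  apply: (can_inj v2rK); rewrite -[LHS]/(L x) -[RHS]/(L _) linear_sum.
  rewrite [LHS]row_sum_delta big_enum; apply: eq_bigr => i _.
  by rewrite linearZ/= r2vK.
apply: (PS) => i _; have [c ->] := usP (v2r x 0 i).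
rewrite scaler_suml; apply: (PS) => u uus; rewrite -scalerA; apply: (PZ).
by apply: Ps; apply/allpairsP; exists (u, i); split=> //=; rewrite mem_enum.
Qed.

End Functionals.

(** * Norming extreme points of the dual ball *)

Section Norming.
Variables (R : realType) (k : scalar_kind).
Local Notation K := (scalars R k).
Local Notation iota := (@real_scalar R k).

Lemma dual_ball_le_norm (X : normedModType K) (f : dual X) (x : X) :
  unit_ball (dual X) f -> `|f x| <= `|x|.
Proof.
move=> f1; have [->|x0] := eqVneq x 0; first by rewrite linear0 !normr0.
have : `|f (`|x|^-1 *: x)| <= 1.
  apply: le_trans f1; apply: dual_norm_ge.
  by rewrite normrZ normfV normr_id mulVf// normr_eq0.
rewrite linearZ/= [`|_|]normrM normfV normr_id mulrC ler_pdivrMr ?normr_gt0//.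
by rewrite mul1r.
Qed.

Lemma norm_sublinear (X : normedModType K) :
  sublinear iota (fun x : X => real_part `|x|).
Proof.
split=> [x y|r x r0].
  by rewrite -real_partD ler_real_part ?addr_ge0// ler_normD.
rewrite normrZ ger0_norm ?real_partZ//.
by rewrite -(rmorph0 iota) ler_real_scalar.
Qed.

(** Continuity comes for free: rotating [f x] to a nonnegative real by a
    unimodular [u] gives [|f x| = f (u x) = g (u x) <= |x|]. *)
Lemma dual_of_real_functional (X : normedModType K) (g : X -> R) :
  real_linear iota g -> (forall x, g x <= real_part `|x|) ->
  exists2 f : dual X, unit_ball (dual X) f & forall x, real_part (f x) = g x.
Proof.
move=> lg gp; have [f [lf fg]] := functional_of_real_part lg.
pose F : {linear X -> K} := HB.pack f (GRing.isLinear.Build K X K *:%R f lf).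
have fle x : `|f x| <= `|x|.
  have [u u1 uE] := norm_rotation (f x).
  have fu : f (u *: x) = `|f x| by rewrite -uE -[LHS]/(F (u *: x)) linearZ.
  rewrite -ler_real_part// -fu fg; apply: le_trans (gp _) _.
  by rewrite normrZ u1 mul1r.
have ff : f \in @functional R k X.
  apply/asboolP; split=> //; rewrite -[f]/(F : X -> K).
  apply/linear_bounded_continuous/bounded_funP => r; exists r => x xr.
  exact: le_trans (fle x) xr.
exists (Dual ff); last exact: fg.
by apply: dual_norm_le => x x1; exact: le_trans (fle x) x1.
Qed.

Lemma real_linear_real_part (X : normedModType K) (f : dual X) :
  real_linear iota (fun x => real_part (f x)).
Proof.
split=> [x y|r x]; first by rewrite linearD real_partD.
by rewrite linearZ real_partZ.
Qed.

(** Real parts identify the dual ball with the set of real-linear functionals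
    below the norm, so the extreme one that attains the norm at [x] is the real
    part of an extreme point of the dual ball. *)
Lemma extreme_norming_functional (X : normedModType K) (s : seq X) (x : X) :
  real_span iota s = setT ->
  exists2 f : dual X, extreme_points (unit_ball (dual X)) f & `|x| <= `|f x|.
Proof.
move=> spans.
have [g [lg gp gx pg]] :=
  extreme_supporting_functional x (norm_sublinear X) spans.
have [f f1 fg] := dual_of_real_functional lg gp.
exists f; last first.
  by rewrite -ler_real_part// -gx -fg real_part_le_norm.
split=> // h1 h2 t h11 h21 /andP[t0 t1] fE.
have tE : t = iota (real_part t) by rewrite -ge0_real_scalar// ltW.
have t01 : 0 < real_part t < 1.
  by rewrite -!(ltr_real_scalar k) rmorph0 rmorph1 -tE t0.
have below (h : dual X) : unit_ball (dual X) h ->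
    forall v, real_part (h v) <= real_part `|v|.
  move=> h1' v; apply: le_trans (real_part_le_norm _) _.
  by rewrite ler_real_part// dual_ball_le_norm.
have gE v : g v =
    real_part t * real_part (h1 v) + (1 - real_part t) * real_part (h2 v).
  have cE : iota (1 - real_part t) = 1 - t by rewrite rmorphB rmorph1 {2}tE.
  by rewrite -fg fE -!real_partZ cE -tE -real_partD.
have eq_f (h : dual X) : (forall v, real_part (h v) <= g v) -> h = f.
  move=> hg; apply/val_inj/linear_eq_real_part; try exact: dual_linear.
  move=> v; rewrite fg.
  by have /(congr1 (@^~ v)) := real_linear_le_eq (real_linear_real_part h) lg hg.
split; apply: eq_f.
  apply: (pg _ (fun v => real_part (h2 v)) (real_part t)) => //;
    [exact: real_linear_real_part|exact: real_linear_real_part|exact: below|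
     exact: below| by move=> v; rewrite gE].
apply: (pg _ (fun v => real_part (h1 v)) (1 - real_part t)) => //;
  [exact: real_linear_real_part|exact: real_linear_real_part|exact: below|
   exact: below| by move: t01; lra | by move=> v; rewrite gE subKr addrC].
Qed.

Lemma polyhedral_finite_norming (X : normedModType K) :
  finite_dimensional X -> polyhedral (dual X) ->
  exists A : seq (dual X), forall x : X,
    (`|x| <= 1) = all (fun f : dual X => `|f x| <= 1) A.
Proof.
move=> /finite_dimensional_real_span[s spans] polX.
have [A [finA A1 extA]] : exists A : set (dual X), [/\ finite_set A,
    A `<=` unit_ball (dual X) & forall f, extreme_points (unit_ball (dual X)) f ->
      exists2 a, A a & forall x, `|f x| = `|a x|].
  move: polX; rewrite /polyhedral; case: k X s spans => X s spans.
    move=> finext; exists (extreme_points (unit_ball (dual X))); split=> //.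
      by move=> f [].
    by move=> f extf; exists f.
  move=> [A [finA Aext extE]]; exists A; split=> // [f /Aext[]//|f].
  rewrite extE => -[[a h] /= [a1 Ah] <-]; exists h => // x.
  by rewrite [LHS]normrM a1 mul1r.
have /finite_seqP[r rE] := finA.
exists r => x; apply/idP/allP => [x1 f fr|fx].
  apply: le_trans (dual_ball_le_norm x (A1 _ _)) x1.
  by rewrite rE.
have [f /extA[a Aa ->] /le_trans] := extreme_norming_functional x spans.
by apply; apply: fx; move: Aa; rewrite rE.
Qed.

End Norming.

(** * Translating a convex combination *)

Lemma common_lower_bound (K : numFieldType) (T : eqType) (s : seq T) (c : T -> K)
    (e : K) :
  0 < e -> (forall a, a \in s -> 0 < c a) ->
  exists d : K, [/\ 0 < d, d <= e & forall a, a \in s -> d <= c a].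
Proof.
move=> e0; elim: s => [|a s ih] c0; first by exists e.
have [b bs|d [d0 de ds]] := ih; first by rewrite c0// inE bs orbT.
have ca0 : 0 < c a by rewrite c0// mem_head.
have [dca|cad] := real_leP (gtr0_real d0) (gtr0_real ca0).
  by exists d; split=> // b; rewrite inE => /predU1P[->|/ds].
exists (c a); split=> // [|b]; first exact: le_trans (ltW cad) de.
by rewrite inE => /predU1P[->//|/ds]; exact: le_trans (ltW cad).
Qed.

(** The maps [v_j u = z_j + (u - x)], where [z_j = (1 - t) y_j + t x], serve for
    a small [t]; the radius is bounded by the gaps [1 - |f z_j|] over the finitely
    many [f] with [|f x| < 1]. *)
Lemma co_cond_of_finite_norming (R : realType) (k : scalar_kind)
    (X : normedModType (scalars R k)) (A : seq (dual X)) :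
  (forall x : X, (`|x| <= 1) = all (fun f : dual X => `|f x| <= 1) A) ->
  forall (x : X) n, unit_ball X x -> co_cond n x.
Proof.
move=> normA x n x1 y l y1 l0 sum_l xE eps eps0.
have A1 (a : dual X) : a \in A -> forall v, `|v| <= 1 -> `|a v| <= 1.
  by move=> aA v; rewrite normA => /allP/(_ _ aA).
have Ale (a : dual X) : a \in A -> forall v, `|a v| <= `|v|.
  by move=> aA v; apply: dual_ball_le_norm; apply: dual_norm_le; exact: A1.
(* Since [|x - y j| <= 2], moving [y j] by [t (x - y j)] costs less than
   [eps / 2]; dividing by [4 + eps] keeps [t < 1] for every [eps]. *)
pose t := eps / (4 + eps).
have e4 : 0 < 4 + eps by rewrite addr_gt0.
have t0 : 0 < t by rewrite divr_gt0.
have t1 : t < 1 by rewrite ltr_pdivrMr// mul1r ltrDr.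
have t2 : t * 2 < eps / 2.
  rewrite /t mulrAC ltr_pdivrMr// mulrAC ltr_pdivlMr// -mulrA ltr_pM2l//.
  by rewrite -natrM ltrDl.
have t1' : 0 <= 1 - t by rewrite subr_ge0 ltW.
clearbody t; pose z j := (1 - t) *: y j + t *: x.
(* A lower bound of [1 - |a (z j)|] when [|a x| < 1]. *)
pose gap (a : dual X) := if `|a x| == 1 then 1 else t * (1 - `|a x|).
have gap0 a : a \in A -> 0 < gap a.
  move=> aA; rewrite /gap; case: eqP => // /eqP ax; rewrite mulr_gt0// subr_gt0.
  by rewrite lt_neqAle ax A1.
have [d [d0 de dgap]] := common_lower_bound (divr_gt0 eps0 (ltr0Sn _ 1)) gap0.
exists d => //=; exists (fun j u => z j + (u - x)); split.
- move=> j; apply: continuous_subspaceT => u.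
  by apply: cvgD; [exact: cvg_cst | apply: cvgD; [exact: cvg_id | exact: cvg_cst]].
- move=> j u [xu u1]; rewrite /unit_ball/= normA; apply/allP => a aA.
  have [ax|ax] := eqVneq `|a x| 1.
    have sumE : \sum_j l j * a (y j) = a x.
      by rewrite xE linear_sum; apply: eq_bigr => i _; rewrite linearZ.
    have ay : a (y j) = a x.
      rewrite -sumE; apply: disc_strictly_convex => // [i|]; last by rewrite sumE.
      exact: A1 aA _ (y1 i).
    have -> : a (z j + (u - x)) = a u.
      rewrite !linearD linearN !linearZ/= ay -scalerDl subrK scale1r.
      by rewrite addrC subrK.
    exact: A1 aA _ u1.
  rewrite linearD (le_trans (ler_normD _ _))//.
  have az : `|a (z j)| <= 1 - gap a.
    have -> : a (z j) = (1 - t) * a (y j) + t * a x by rewrite linearD !linearZ.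
    rewrite /gap (negbTE ax) (le_trans (ler_normD _ _))//.
    rewrite !normrM (ger0_norm t1') (gtr0_norm t0).
    have -> : 1 - t * (1 - `|a x|) = (1 - t) * 1 + t * `|a x| by ring.
    by rewrite lerD2r ler_wpM2l// A1//; exact: y1.
  have au : `|a (u - x)| <= gap a.
    apply: le_trans (Ale _ aA _) _; apply: le_trans (dgap _ aA).
    by move: xu; rewrite -ball_normE/= distrC => /ltW.
  by rewrite -[leRHS](subrK (gap a)) lerD.
- move=> u _; under eq_bigr do rewrite scalerDr.
  rewrite big_split/= -scaler_suml sum_l scale1r.
  suff -> : \sum_j l j *: z j = x by rewrite addrC subrK.
  under eq_bigr do rewrite scalerDr !scalerA [l _ * (1 - t)]mulrC -[in X in X + _]scalerA.
  rewrite big_split/= -scaler_sumr -xE -scaler_suml -mulr_suml sum_l mul1r.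
  by rewrite -scalerDl subrK scale1r.
- move=> j u [xu u1].
  have -> : z j + (u - x) - y j = t *: (x - y j) + (u - x).
    by rewrite /z scalerBl scale1r scalerBr addrAC; congr (_ + _);
       rewrite addrAC [y j - _]addrC addrK addrC.
  rewrite (le_lt_trans (ler_normD _ _))// [ltRHS](splitr eps).
  rewrite ltrD//; last first.
    by move: xu; rewrite -ball_normE/= distrC => /lt_le_trans; apply.
  rewrite normrZ (gtr0_norm t0); apply: le_lt_trans t2; rewrite ler_pM2l//.
  rewrite (le_trans (ler_normB _ _))// -[2]/(1 + 1) lerD//; exact: y1.
Qed.

Theorem proposition3p5 (R : realType) (k : scalar_kind)
    (X : completeNormedModType (scalars R k)) (hfin : finite_dimensional X)
    (hdual : polyhedral (dual X)) :
  property_co2 X /\ property_co X.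
Proof.
have [A normA] := polyhedral_finite_norming hfin hdual.
by split=> [x x1|x x1 n _]; exact: (co_cond_of_finite_norming normA).
Qed.
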